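(* Every graph $G$ with at least one edge satisfies $$a(G)+\sigma_\Delta(G)=\frac{\Delta(G)+1}{2}\,W(G).$$ In particular, $$a(G)\leq \frac{\Delta(G)+1}{2}\,W(G),$$ with the loss from equality measured exactly by $\sigma_\Delta(G)$.
   Context: All graphs are finite, simple and undirected. Let $G$ have $n$ vertices, $m(G)\geq 1$ edges, degree sequence $d_1\leq d_2\leq\cdots\leq d_n$ and maximum degree $\Delta=\Delta(G)$. The annihilation number is $a=a(G)=\max\{k : \sum_{i=1}^k d_i\leq m(G)\}$. The Caro–Wei sum is $W(G)=\sum_{i=1}^n\frac{1}{d_i+1}$. Put $S_H(G)=\sum_{i=1}^{a}d_i$ and define $$\sigma_\Delta(G)=\frac{\Delta(n-a)-S_H(G)}{2\Delta}+\sum_{i=1}^{a}\frac{(\Delta-d_i)(\Delta-d_i-1)}{2\Delta(d_i+1)}+\sum_{i=a+1}^{n}\frac{\Delta-d_i}{2(d_i+1)} .$$ *)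

(* Defs.v *)
(* A graph on a finite vertex type T is given by its adjacency
   relation e : rel T, assumed symmetric and irreflexive. *)
From mathcomp Require Import all_boot all_order all_algebra.

Set Implicit Arguments.
Unset Strict Implicit.
Unset Printing Implicit Defensive.

Import Order.TTheory GRing.Theory Num.Theory.

Section Graph.
Variables (T : finType) (e : rel T).

Definition edges : {set {set T}} :=
  [set E : {set T} | [exists x, exists y, e x y && (E == [set x; y])]].

Definition nb_edges : nat := #|edges|.

Definition degree (x : T) : nat := #|[set y | e x y]|.

Definition max_degree : nat := \max_(x : T) degree x.

Definition degree_seq : seq nat := sort leq [seq degree x | x <- enum T].

(* Indices are shifted by one: [deg_nth i] is d_(i+1) in the usual notation
   d_1 <= ... <= d_n, so the indices 1..k become 0 <= i < k. *)
Definition deg_nth (i : nat) : nat := nth 0 degree_seq i.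

Definition annihilation : nat :=
  \max_(k < #|T|.+1 | \sum_(0 <= i < k) deg_nth i <= nb_edges) k.

Definition head_sum : nat := \sum_(0 <= i < annihilation) deg_nth i.

Local Open Scope ring_scope.

Definition caro_wei : rat :=
  \sum_(0 <= i < #|T|) 1 / ((deg_nth i)%:R + 1).

Definition sigma : rat :=
  let D : rat := max_degree%:R in
  let n : rat := #|T|%:R in
  let a : rat := annihilation%:R in
  let S : rat := head_sum%:R in
  let d (i : nat) : rat := (deg_nth i)%:R in
  (D * (n - a) - S) / (2 * D)
  + \sum_(0 <= i < annihilation)
      (D - d i) * (D - d i - 1) / (2 * D * (d i + 1))
  + \sum_(annihilation <= i < #|T|)
      (D - d i) / (2 * (d i + 1)).

End Graph.

(* Main.v *)
(** Rewrite [(D + 1) / (2 (d + 1))] as [1/2 + (D - d) / (2 (d + 1))] for the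
    vertices outside the annihilating prefix, and as
    [1 - d / (2 D) + (D - d) (D - d - 1) / (2 D (d + 1))] for those inside it;
    summing over all vertices gives the identity.  Every summand of [sigma] is
    nonnegative: [(D - d) (D - d - 1)] is a product of consecutive integers,
    and since the degrees sum to at least twice the number of edges, the head
    sum is at most the tail sum, itself at most [D (n - a)]. *)
Require Import Defs.
From mathcomp Require Import all_boot all_order all_algebra.
From mathcomp Require Import ring.

Set Implicit Arguments.
Unset Strict Implicit.
Unset Printing Implicit Defensive.

Import Order.TTheory GRing.Theory Num.Theory.
Local Open Scope ring_scope.

(** One half of the handshake identity: the degree sum counts ordered adjacent pairs, and these are
    grouped by the edge [ends] they span. By symmetry and irreflexivity each edge receives at least
    the two distinct pairs [(x, y)] and [(y, x)]. *)
Lemma double_nb_edges_le (T : finType) (e : rel T) :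
  symmetric e -> irreflexive e ->
  (2 * nb_edges e <= \sum_(x : T) degree e x)%N.
Proof.
move=> e_sym e_irr.
pose ends (p : T * T) : {set T} := [set p.1; p.2].
have ->: (\sum_x degree e x = \sum_(p : T * T | e p.1 p.2) 1)%N.
  rewrite -(pair_big_dep xpredT e (fun _ _ => 1%N)) /=.
  by apply: eq_bigr => x _; rewrite /degree cardsE sum1_card.
rewrite (partition_big ends (mem (edges e))) /=; last first.
  move=> [x y] /= exy; rewrite inE; apply/existsP; exists x.
  by apply/existsP; exists y; rewrite exy eqxx.
rewrite mulnC /nb_edges -sum_nat_const; apply: leq_sum => E.
rewrite inE => /existsP[x /existsP[y /andP[exy /eqP ->]]].
have neq_xy : x != y by apply/eqP => eq_xy; rewrite eq_xy e_irr in exy.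
rewrite sum1_card -[2%N](_ : #|[set (x, y); (y, x)]| = 2%N); last first.
  by rewrite cards2 xpair_eqE negb_and neq_xy.
apply/subset_leq_card/subsetP => p /set2P[] ->; rewrite unfold_in /ends /=.
  by rewrite exy eqxx.
by rewrite e_sym exy setUC eqxx.
Qed.

Lemma size_degree_seq (T : finType) (e : rel T) : size (degree_seq e) = #|T|.
Proof. by rewrite size_sort size_map -cardE. Qed.

Lemma sum_deg_nth (T : finType) (e : rel T) :
  (\sum_(0 <= i < #|T|) deg_nth e i = \sum_(x : T) degree e x)%N.
Proof.
rewrite -(size_degree_seq e) -(big_nth 0%N xpredT id).
by rewrite (perm_big _ (permEl (perm_sort _ _))) big_map big_enum.
Qed.

Lemma deg_nth_le_max (T : finType) (e : rel T) (i : nat) :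
  (deg_nth e i <= max_degree e)%N.
Proof.
(* Past the end of the sequence [nth] returns the default 0. *)
have [ltin|leni] := ltnP i #|T|; last first.
  by rewrite /deg_nth nth_default // size_degree_seq.
have: deg_nth e i \in degree_seq e by rewrite mem_nth ?size_degree_seq.
by rewrite mem_sort => /mapP[x _ ->]; apply: leq_bigmax.
Qed.

Lemma annihilation_le (T : finType) (e : rel T) : (annihilation e <= #|T|)%N.
Proof. by apply/bigmax_leqP => k _; rewrite -ltnS. Qed.

(** The maximum is itself admissible: the defining bound holds at 0 by the empty sum and passes to
    the larger of two admissible indices. *)
Lemma head_sum_le (T : finType) (e : rel T) : (head_sum e <= nb_edges e)%N.
Proof.
rewrite /head_sum /annihilation.
apply: (big_ind (fun k => \sum_(0 <= i < k) deg_nth e i <= nb_edges e)%N) => //.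
  by rewrite big_geq.
by move=> k l; rewrite /maxn; case: ifP.
Qed.

Lemma head_sum_le_max_degree (T : finType) (e : rel T) :
  symmetric e -> irreflexive e ->
  (head_sum e <= max_degree e * (#|T| - annihilation e))%N.
Proof.
move=> e_sym e_irr.
have := double_nb_edges_le e_sym e_irr.
rewrite -sum_deg_nth (big_cat_nat (leq0n _) (annihilation_le e)) /=.
rewrite -/(head_sum e) => le_sum.
have tail_le : (\sum_(annihilation e <= i < #|T|) deg_nth e i
                <= max_degree e * (#|T| - annihilation e))%N.
  by rewrite mulnC -sum_nat_const_nat leq_sum // => i _; apply: deg_nth_le_max.
(* Adding the head sum to both sides of head <= tail leaves twice the head sum against the full
   degree sum, with [2 * nb_edges e] in between. *)
apply: leq_trans tail_le; rewrite -(leq_add2l (head_sum e)).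
apply: leq_trans le_sum; rewrite mul2n -addnn.
by apply: leq_add; apply: head_sum_le.
Qed.

Lemma max_degree_gt0 (T : finType) (e : rel T) :
  (0 < nb_edges e)%N -> (0 < max_degree e)%N.
Proof.
case/card_gt0P => E; rewrite inE => /existsP[x /existsP[y /andP[exy _]]].
apply: leq_trans (leq_bigmax x); apply/card_gt0P; exists y.
by rewrite inE.
Qed.

Lemma annihilation_sigma (T : finType) (e : rel T) :
  (0 < max_degree e)%N ->
  (annihilation e)%:R + sigma e = ((max_degree e)%:R + 1) / 2 * caro_wei e.
Proof.
rewrite -(ltr0n rat) => D_gt0; rewrite /sigma /caro_wei.
set D : rat := (max_degree e)%:R in D_gt0 *; set a := annihilation e.
have D_neq0 : D != 0 by rewrite gt_eqF.
have d1_neq0 i : (deg_nth e i)%:R + 1 != 0 :> rat.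
  by rewrite gt_eqF // ltr_wpDl ?ler0n.
have le_an : (a <= #|T|)%N := annihilation_le e.
rewrite mulr_sumr (big_cat_nat (leq0n a) le_an) /=.
have -> : \sum_(0 <= i < a) (D + 1) / 2 * (1 / ((deg_nth e i)%:R + 1))
  = a%:R - (head_sum e)%:R / (2 * D)
    + \sum_(0 <= i < a) (D - (deg_nth e i)%:R) * (D - (deg_nth e i)%:R - 1)
                        / (2 * D * ((deg_nth e i)%:R + 1)).
  have -> : a%:R = \sum_(0 <= i < a) 1 :> rat.
    by rewrite sumr_const_nat subn0.
  rewrite natr_sum mulr_suml -sumrB -big_split /=.
  by apply: eq_bigr => i _; field; rewrite D_neq0 d1_neq0.
have -> : \sum_(a <= i < #|T|) (D + 1) / 2 * (1 / ((deg_nth e i)%:R + 1))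
  = (#|T|%:R - a%:R) / 2
    + \sum_(a <= i < #|T|) (D - (deg_nth e i)%:R)
                           / (2 * ((deg_nth e i)%:R + 1)).
  have -> : (#|T|%:R - a%:R) / 2 = \sum_(a <= i < #|T|) 2^-1 :> rat.
    by rewrite sumr_const_nat -natrB // mulr_natl.
  by rewrite -big_split /=; apply: eq_bigr => i _; field; rewrite d1_neq0.
(* The first term of [sigma] splits as [(n - a) / 2 - S / (2 * D)], matching the constants released
   by the two sums. *)
by field.
Qed.

Lemma sigma_ge0 (T : finType) (e : rel T) :
  symmetric e -> irreflexive e -> 0 <= sigma e.
Proof.
move=> e_sym e_irr; rewrite /sigma.
have d1_ge0 i : 0 <= (deg_nth e i)%:R + 1 :> rat by rewrite addr_ge0.
apply: addr_ge0; first apply: addr_ge0.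
- rewrite divr_ge0 ?mulr_ge0 // subr_ge0 -natrB ?annihilation_le //.
  by rewrite -natrM ler_nat head_sum_le_max_degree.
- apply: sumr_ge0 => i _; apply: divr_ge0; last by rewrite !mulr_ge0.
  (* If [D - d] is 0, the factor [D - d - 1] is negative but the product vanishes; otherwise the
     factors are [k + 1] and [k]. *)
  rewrite -natrB ?deg_nth_le_max //; case: (_ - _)%N => [|k].
    by rewrite mul0r.
  by rewrite -natr1 addrK mulr_ge0 ?addr_ge0.
apply: sumr_ge0 => i _; rewrite divr_ge0 ?mulr_ge0 //.
by rewrite subr_ge0 ler_nat deg_nth_le_max.
Qed.

Theorem theorem7p3 (T : finType) (e : rel T)
    (e_sym : symmetric e) (e_irr : irreflexive e)
    (e_edge : (1 <= nb_edges e)%N) :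
  [/\ (annihilation e)%:R + sigma e
        = ((max_degree e)%:R + 1) / 2 * caro_wei e,
      (annihilation e)%:R <= ((max_degree e)%:R + 1) / 2 * caro_wei e
    & ((max_degree e)%:R + 1) / 2 * caro_wei e - (annihilation e)%:R
        = sigma e].
Proof.
(* With the Caro-Wei side replaced by [a + sigma], the claims become reflexivity, [0 <= sigma] and
   cancellation of [a]. *)
have <- := annihilation_sigma (max_degree_gt0 e_edge).
by split; rewrite ?lerDl ?sigma_ge0 // addrC addKr.
Qed.
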